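(* Let $k$ be a field, $G$ an abelian group and $\mathfrak{h}$ a finite dimensional Leibniz algebra over $k$. Then there exists a bijection between the set of all $G$-gradings on $\mathfrak{h}$ and the set of all bialgebra homomorphisms $\mathcal{A}(\mathfrak{h})\to k[G]$. The bijection is such that the $G$-grading $\mathfrak{h}=\oplus_{\sigma\in G}\mathfrak{h}_\sigma^{(\theta)}$ associated to a bialgebra homomorphism $\theta:\mathcal{A}(\mathfrak{h})\to k[G]$ is given by $$\mathfrak{h}_\sigma^{(\theta)}:=\{x\in\mathfrak{h}\mid(\mathrm{Id}_{\mathfrak{h}}\otimes\theta)\circ\eta_{\mathfrak{h}}(x)=x\otimes\sigma\}$$ for all $\sigma\in G$.
   Context: All vector spaces, algebras and tensor products are over an arbitrary field $k$; algebras are unital and algebra homomorphisms preserve units. A Leibniz algebra is a vector space $\mathfrak{h}$ with a bilinear map $[-,-]$ satisfying $[x,[y,z]] = [[x,y],z]-[[x,z],y]$ for all $x,y,z$; homomorphisms are bracket-preserving linear maps. $k[G]$ is the group algebra with its usual bialgebra structure. A $G$-grading on $\mathfrak{h}$ is a vector space decomposition $\mathfrak{h}=\oplus_{\sigma\in G}\mathfrak{h}_\sigma$ such that $[\mathfrak{h}_\sigma,\mathfrak{h}_\tau]\subseteq\mathfrak{h}_{\sigma\tau}$ for all $\sigma,\tau\in G$. Universal coacting bialgebra $(\mathcal{A}(\mathfrak{h}),\eta_{\mathfrak{h}})$: fix a basis $\{e_1,\dots,e_n\}$ of $\mathfrak{h}$, with structure constants $[e_i,e_j]=\sum_{s=1}^n\tau_{i,j}^s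 e_s$. Then $\mathcal{A}(\mathfrak{h}):=k[X_{ij}\mid i,j=1,\dots,n]/J$, where $J$ is the ideal generated by the polynomials $$\sum_{u=1}^n\tau_{i,j}^u X_{au}-\sum_{s,t=1}^n\tau_{s,t}^a X_{si}X_{tj},\qquad a,i,j=1,\dots,n.$$ Write $x_{ij}$ for the class of $X_{ij}$. $\mathcal{A}(\mathfrak{h})$ is a commutative bialgebra with $\Delta(x_{ij})=\sum_{s=1}^n x_{is}\otimes x_{sj}$ and $\varepsilon(x_{ij})=\delta_{i,j}$. The map $\eta_{\mathfrak{h}}:\mathfrak{h}\to\mathfrak{h}\otimes\mathcal{A}(\mathfrak{h})$ is the linear map given by $\eta_{\mathfrak{h}}(e_i):=\sum_{s=1}^n e_s\otimes x_{si}$. *)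

(* Defs.v *)
From HB Require Import structures.
From mathcomp Require Import all_boot all_order all_algebra finmap.
From mathcomp Require Import boolp classical_sets.
From mathcomp Require Import mpoly monalg.

Set Implicit Arguments.
Unset Strict Implicit.
Unset Printing Implicit Defensive.

Import GRing.Theory.
Local Open Scope quotient_scope.
Local Open Scope ring_scope.

Section LinearFun.
Variables (k : fieldType) (V W : lmodType k) (f : V -> W).
Hypothesis fL : linear f.

Lemma lin0 : f 0 = 0.
Proof. by rewrite -[0](addNr 0) -scaleN1r fL scaleN1r addNr. Qed.
Lemma linD x y : f (x + y) = f x + f y.
Proof. by rewrite -[x in LHS]scale1r fL scale1r. Qed.
Lemma linZ a x : f (a *: x) = a *: f x.
Proof. by rewrite -[a *: x]addr0 fL lin0 addr0. Qed.
Lemma linB x y : f (x - y) = f x - f y.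
Proof. by rewrite linD -scaleN1r linZ scaleN1r. Qed.
End LinearFun.

Section FreeLift.
Variables (k : fieldType) (K : choiceType) (W : lmodType k).
Implicit Types (f g : K -> W) (p q : {malg k[K]}).

Definition free_lift f p : W := \sum_(x <- msupp p) mcoeff x p *: f x.

Lemma free_liftEw f p (d : {fset K}) : (msupp p `<=` d)%fset ->
  free_lift f p = \sum_(x <- d) mcoeff x p *: f x.
Proof.
move=> le_pd; rewrite /free_lift (big_fset_incl _ le_pd) //= => x _.
by move=> /mcoeff_outdom ->; rewrite scale0r.
Qed.

Lemma free_lift_linear f : linear (free_lift f).
Proof.
move=> a p q; pose d := (msupp (a *: p + q) `|` (msupp p `|` msupp q))%fset.
rewrite (@free_liftEw f (a *: p + q) d) ?fsubsetUl //.
rewrite (@free_liftEw f p d); last first.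
  by rewrite /d fsetUCA fsubsetUl.
rewrite (@free_liftEw f q d); last first.
  by rewrite /d fsetUA fsubsetUr.
rewrite scaler_sumr -big_split /=; apply: eq_bigr => x _.
by rewrite mcoeffD mcoeffZ scalerDl scalerA.
Qed.

Lemma free_liftU f x : free_lift f << x >> = f x.
Proof.
by rewrite (@free_liftEw f _ [fset x]%fset) ?msuppU_le // big_seq_fset1
  mcoeffUU scale1r.
Qed.

Lemma eq_free_lift f g : f =1 g -> free_lift f =1 free_lift g.
Proof. by move=> fg p; apply: eq_bigr => x _; rewrite fg. Qed.

Lemma free_liftP f g a p :
  free_lift (fun x => a *: f x + g x) p = a *: free_lift f p + free_lift g p.
Proof.
rewrite /free_lift scaler_sumr -big_split; apply: eq_bigr => x _ /=.
by rewrite scalerDr !scalerA mulrC.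
Qed.

End FreeLift.

Lemma malg_ind (k : fieldType) (K : choiceType) (P : {malg k[K]} -> Prop) :
  P 0 -> (forall a x p, P p -> P (a *: << x >> + p)) -> forall p, P p.
Proof.
move=> P0 PD p; rewrite [p]monalgE; elim: (X in \sum_(_ <- X) _) => [|x s IH].
  by rewrite big_nil.
rewrite big_cons; suff -> : << mcoeff x p *g x >> = mcoeff x p *: << x >> :> {malg k[K]}.
  exact: PD.
by apply/malgP => y; rewrite mcoeffZ !mcoeffU mulr_natr.
Qed.

Definition bilin (k : fieldType) (U V W : lmodType k) (f : U -> V -> W) : Prop :=
  (forall v, linear (f^~ v)) /\ (forall u, linear (f u)).

(* The operations on tensors are locked so that unification does not unfold
   them down to representatives. *)
Fact tens_key : unit. Proof. by []. Qed.

Section Tensor.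
Variables (k : fieldType) (U V : lmodType k).
Local Notation F := {malg k[(U * V)%type]}.

(* The subspace of the free space on U * V spanned by the bilinearity
   relations. *)
Inductive tens_rel : F -> Prop :=
| TensRel0 : tens_rel 0
| TensRelC a p q : tens_rel p -> tens_rel q -> tens_rel (a *: p + q)
| TensRelL a u u' v :
    tens_rel (<< (a *: u + u', v) >> - (a *: << (u, v) >> + << (u', v) >>))
| TensRelR a u v v' :
    tens_rel (<< (u, a *: v + v') >> - (a *: << (u, v) >> + << (u, v') >>)).

Definition tens_ker : {pred F} := fun p => `[< tens_rel p >].

Fact tens_ker_zmod : zmod_closed tens_ker.
Proof.
split=> [|p q /asboolP Kp /asboolP Kq]; apply/asboolP; first exact: TensRel0.
by rewrite addrC -scaleN1r; apply: TensRelC.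
Qed.
HB.instance Definition _ := GRing.isZmodClosed.Build F tens_ker tens_ker_zmod.

Definition tensor : Type := {ideal_quot tens_ker}.
HB.instance Definition _ := GRing.Zmodule.on tensor.

Local Notation cls := (\pi_({ideal_quot tens_ker}) : F -> tensor).

Let cls_eq (p q : F) : (cls p = cls q) <-> tens_rel (p - q).
Proof.
split.
  move=> /eqP e; apply/asboolP; change (p - q \in tens_ker).
  by rewrite Quotient.idealrBE.
by move=> /asboolP H; apply/eqP; rewrite -(Quotient.idealrBE tens_ker).
Qed.

Let clsD p q : cls (p + q) = cls p + cls q.
Proof. exact: (raddfD (\pi_({ideal_quot tens_ker}))). Qed.

Let repr_cls p : tens_rel (repr (cls p) - p).
Proof. by apply/cls_eq; exact: reprK. Qed.

Definition tens_scale : k -> tensor -> tensor :=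
  locked_with tens_key (fun a t => cls (a *: repr t)).
Canonical tens_scale_unlockable := [unlockable of tens_scale].

Let clsZ a p : tens_scale a (cls p) = cls (a *: p).
Proof.
rewrite [tens_scale]unlock; apply/cls_eq; rewrite -scalerBr -[_ *: _]addr0.
by apply: TensRelC (TensRel0); apply: repr_cls.
Qed.

Let tensP (t : tensor) : exists p, t = cls p.
Proof. by exists (repr t); rewrite /= reprK. Qed.

Fact tens_scaleA a b t : tens_scale a (tens_scale b t) = tens_scale (a * b) t.
Proof. by have [p ->] := tensP t; rewrite !clsZ scalerA. Qed.
Fact tens_scale1 : left_id 1 tens_scale.
Proof. by move=> t; have [p ->] := tensP t; rewrite clsZ scale1r. Qed.
Fact tens_scaleDr : right_distributive tens_scale +%R.
Proof.
move=> a t t'; have [p ->] := tensP t; have [q ->] := tensP t'.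
by rewrite -clsD !clsZ scalerDr clsD.
Qed.
Fact tens_scaleDl t : {morph tens_scale^~ t : a b / a + b}.
Proof. by move=> a b; have [p ->] := tensP t; rewrite !clsZ scalerDl clsD. Qed.
HB.instance Definition _ := GRing.Zmodule_isLmodule.Build k tensor
  tens_scaleA tens_scale1 tens_scaleDr tens_scaleDl.

Definition tens : U -> V -> tensor :=
  locked_with tens_key (fun u v => cls << (u, v) >>).
Canonical tens_unlockable := [unlockable of tens].

Let tensE u v : tens u v = cls << (u, v) >>.
Proof. by rewrite unlock. Qed.

Let cls_linear : linear cls.
Proof. by move=> a p q; rewrite clsD -clsZ. Qed.

Lemma tens_bilin : bilin tens.
Proof.
split=> [v a u u'|u a v v']; rewrite !tensE -cls_linear; apply/cls_eq.
  exact: TensRelL.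
exact: TensRelR.
Qed.

Lemma tensDl u u' v : tens (u + u') v = tens u v + tens u' v.
Proof. exact: (linD (tens_bilin.1 v)). Qed.
Lemma tensDr u v v' : tens u (v + v') = tens u v + tens u v'.
Proof. exact: (linD (tens_bilin.2 u)). Qed.
Lemma tensZl a u v : tens (a *: u) v = a *: tens u v.
Proof. exact: (linZ (tens_bilin.1 v)). Qed.
Lemma tensZr a u v : tens u (a *: v) = a *: tens u v.
Proof. exact: (linZ (tens_bilin.2 u)). Qed.
Lemma tens0l v : tens 0 v = 0.
Proof. exact: (lin0 (tens_bilin.1 v)). Qed.
Lemma tens0r u : tens u 0 = 0.
Proof. exact: (lin0 (tens_bilin.2 u)). Qed.
Lemma tens_suml (I : Type) (r : seq I) (f : I -> U) v :
  tens (\sum_(i <- r) f i) v = \sum_(i <- r) tens (f i) v.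
Proof. exact: (big_morph (tens^~ v) (fun u u' => tensDl u u' v) (tens0l v)). Qed.
Lemma tens_sumr (I : Type) (r : seq I) u (f : I -> V) :
  tens u (\sum_(i <- r) f i) = \sum_(i <- r) tens u (f i).
Proof. exact: (big_morph (tens u) (tensDr u) (tens0r u)). Qed.

Lemma tens_ind (P : tensor -> Prop) :
  P 0 -> (forall a u v t, P t -> P (a *: tens u v + t)) -> forall t, P t.
Proof.
move=> P0 PD t; have [p ->] := tensP t.
elim/malg_ind: p => [|a [u v] p IH]; last first.
  by rewrite cls_linear -tensE; apply: PD.
by rewrite (raddf0 (\pi_({ideal_quot tens_ker}))).
Qed.

Section Lift.
Variable W : lmodType k.
Implicit Type f : U -> V -> W.

(* For a bilinear f, this is the linear map induced on the tensor product. *)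
Definition tens_lift : (U -> V -> W) -> tensor -> W :=
  locked_with tens_key (fun f t => free_lift (fun p => f p.1 p.2) (repr t)).
Canonical tens_lift_unlockable := [unlockable of tens_lift].

Let lift_rel f p : bilin f -> tens_rel p ->
  free_lift (fun p => f p.1 p.2) p = 0.
Proof.
move=> [fl fr]; pose L := free_lift (fun p => f p.1 p.2).
have LL : linear L by apply: free_lift_linear.
elim=> [|a p1 q _ + _|a u u' v|a u v v']; rewrite -/L ?(lin0 LL) //.
- by move=> p0 q0; rewrite LL p0 q0 scaler0 addr0.
- by rewrite (linB LL) LL /L !free_liftU /= fl subrr.
- by rewrite (linB LL) LL /L !free_liftU /= fr subrr.
Qed.

Let lift_cls f p : bilin f ->
  tens_lift f (cls p) = free_lift (fun p => f p.1 p.2) p.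
Proof.
move=> fB; rewrite [tens_lift]unlock; have := lift_rel fB (repr_cls p).
set L := free_lift _; have LL : linear L by apply: free_lift_linear.
by rewrite (linB LL) => /subr0_eq.
Qed.

Lemma tens_liftE f u v : bilin f -> tens_lift f (tens u v) = f u v.
Proof. by move=> fB; rewrite tensE lift_cls // free_liftU. Qed.

Lemma tens_lift_linear f : bilin f -> linear (tens_lift f).
Proof.
move=> fB a t t'; have [p ->] := tensP t; have [q ->] := tensP t'.
by rewrite -cls_linear !lift_cls // free_lift_linear.
Qed.

Lemma eq_tens_lift f g : f =2 g -> tens_lift f =1 tens_lift g.
Proof. by move=> fg t; rewrite [tens_lift]unlock; apply: eq_free_lift => -[u v] /=. Qed.

Lemma tens_liftP f g a t :
  tens_lift (fun u v => a *: f u v + g u v) t =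
  a *: tens_lift f t + tens_lift g t.
Proof. by rewrite [tens_lift]unlock -free_liftP. Qed.

Lemma tens_ext (f g : tensor -> W) : linear f -> linear g ->
  (forall u v, f (tens u v) = g (tens u v)) -> f =1 g.
Proof.
move=> fL gL fg; elim/tens_ind => [|a u v t IH]; last by rewrite fL gL fg IH.
by rewrite !lin0.
Qed.

End Lift.
End Tensor.

Arguments tensor {k} U%_type V%_type.
Arguments tens {k U V} u v.
Notation "U ⊗ V" := (tensor U V) (at level 40, left associativity) : type_scope.
Notation "u ⊗ v" := (tens u v) (at level 40, left associativity) : ring_scope.

(* Any nonzero vector takes the value 1 at some linear form; this is what makes
   the tensor product of two nonzero algebras nonzero. *)
Lemma exists_form (k : fieldType) (V : lmodType k) (x : V) : x != 0 ->
  exists2 phi : V -> k^o, linear phi & phi x = 1.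
Proof.
move=> x0; pose cl (M : set V) u := M u \/ u = 0.
pose P (M : set V) :=
  (forall a u v, cl M u -> cl M v -> cl M (a *: u + v)) /\ ~ M x.
have [|M [[Ms Mx] Mmax]] := @Zorn_bigcup V P.
  move=> C CP Ctot; split=> [a u v|[M CM Mx]]; last exact: ((CP _ CM).2 Mx).
  have sub M w : C M -> cl M w -> cl (\bigcup_(X in C) X)%classic w.
    by move=> CM [Mw|->]; [left; exists M|right].
  case=> [[M CM Mu]|->]; last first.
    case=> [[N CN Nv]|->]; last by right; rewrite scaler0 addr0.
    by apply: (sub N) => //; apply: (CP _ CN).1; [right|left].
  case=> [[N CN Nv]|->]; last first.
    by apply: (sub M) => //; apply: (CP _ CM).1; [left|right].
  have [MN|NM] := Ctot _ _ CM CN.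
    by apply: (sub N) => //; apply: (CP _ CN).1; left => //; apply: MN.
  by apply: (sub M) => //; apply: (CP _ CM).1; left => //; apply: NM.
have cl0 : cl M 0 by right.
have clZ a u : cl M u -> cl M (a *: u).
  by move=> Mu; rewrite -[_ *: _]addr0; apply: Ms.
have clx : ~ cl M x by case=> // x00; rewrite x00 eqxx in x0.
have ex y : exists c, cl M (y - c *: x).
  have [My|nMy] := EM (cl M y); first by exists 0; rewrite scale0r subr0.
  pose N := [set w | exists a m, cl M m /\ w = a *: y + m]%classic.
  have Ncl w : cl N w -> N w.
    by case=> // ->; exists 0, 0; rewrite scale0r addr0.
  have [[a [m [Mm xE]]]|nNx] := EM (N x).
    have [a0|a0] := eqVneq a 0.
      by case: clx; rewrite xE a0 scale0r add0r.
    exists a^-1; rewrite xE scalerDr scalerA mulVf // scale1r opprD addNKr.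
    by rewrite -scaleNr; apply: clZ.
  case: (Mmax N); last first.
    split=> // a u v /Ncl[b [m [Mm ->]]] /Ncl[c [m' [Mm' ->]]]; left.
    exists (a * b + c), (a *: m + m'); split; first exact: Ms.
    by rewrite scalerDr scalerA addrACA scalerDl.
  split=> [|NM]; first by move=> w Mw; exists 0, w; split; [left|rewrite scale0r add0r].
  by apply: nMy; left; apply: NM; exists 1, 0; rewrite scale1r addr0.
have uniq_c y c c' : cl M (y - c *: x) -> cl M (y - c' *: x) -> c = c'.
  move=> h h'; apply/eqP; apply: contra_notT clx => cc'.
  have := clZ (c' - c)^-1 _ (Ms (-1) _ _ h' h).
  rewrite scaleN1r opprB -addrA addKr -scalerBl scalerA mulVf ?scale1r //.
  by rewrite subr_eq0 eq_sym.
pose phi y : k^o := sval (cid (ex y)).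
have phiP y : cl M (y - phi y *: x) by rewrite /phi; case: cid.
exists phi; last by apply: (uniq_c x) => //; rewrite scale1r subrr.
move=> a u v; apply: (uniq_c (a *: u + v)) => //.
have -> : a *: u + v - (a *: phi u + phi v) *: x =
  a *: (u - phi u *: x) + (v - phi v *: x).
  by rewrite scalerDl opprD addrACA scalerBr scalerA.
exact: Ms.
Qed.

Section TensorAlgebra.
Variables (k : fieldType) (A B : algType k).
Local Notation T := (A ⊗ B)%type.
Implicit Types (x y z : T).

Definition tens_one : T := 1 ⊗ 1.

Definition tens_mul : T -> T -> T := locked_with tens_key (fun x y =>
  tens_lift (fun a b => tens_lift (fun a' b' => (a * a') ⊗ (b * b')) y) x).
Canonical tens_mul_unlockable := [unlockable of tens_mul].

Let inner a b : bilin (fun a' b' => (a * a') ⊗ (b * b') : T).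
Proof.
have [tl tr] := @tens_bilin k A B.
by split=> [v c u u'|u c v v']; rewrite mulrDr -scalerAr ?tl ?tr.
Qed.

Let outer y : bilin (fun a b => tens_lift (fun a' b' => (a * a') ⊗ (b * b') : T) y).
Proof.
have [tl tr] := @tens_bilin k A B.
by split=> [v c u u'|u c v v']; rewrite -tens_liftP; apply: eq_tens_lift => a b;
  rewrite mulrDl -scalerAl ?tl ?tr.
Qed.

Lemma tens_mulE a b a' b' :
  tens_mul (a ⊗ b) (a' ⊗ b') = (a * a') ⊗ (b * b').
Proof. by rewrite [tens_mul]unlock !tens_liftE. Qed.

Fact tens_mul_linearl y : linear (tens_mul^~ y).
Proof. by move=> c x x'; rewrite [tens_mul]unlock tens_lift_linear. Qed.

Fact tens_mul_linearr x : linear (tens_mul x).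
Proof.
move=> a y y'; rewrite [tens_mul]unlock -tens_liftP; apply: eq_tens_lift => u v.
by rewrite tens_lift_linear.
Qed.

Let mulPl c x x' y : tens_mul (c *: x + x') y = c *: tens_mul x y + tens_mul x' y.
Proof. exact: tens_mul_linearl. Qed.

Let mulPr c x y y' : tens_mul x (c *: y + y') = c *: tens_mul x y + tens_mul x y'.
Proof. exact: tens_mul_linearr. Qed.

Let mul0l y : tens_mul 0 y = 0.
Proof. exact: (lin0 (tens_mul_linearl y)). Qed.

Let mul0r x : tens_mul x 0 = 0.
Proof. exact: (lin0 (tens_mul_linearr x)). Qed.

Fact tens_mulA : associative tens_mul.
Proof.
move=> x y z; elim/tens_ind: x => [|c a b x IH]; first by rewrite !mul0l.
rewrite !mulPl IH; congr (_ *: _ + _) => {x IH}.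
elim/tens_ind: y => [|c' a' b' y IH]; first by rewrite mul0l !mul0r mul0l.
rewrite mulPl !mulPr mulPl IH; congr (_ *: _ + _) => {y IH}.
elim/tens_ind: z => [|c'' a'' b'' z IH]; first by rewrite !mul0r.
by rewrite !mulPr IH !tens_mulE !mulrA.
Qed.

Fact tens_mul1 : left_id tens_one tens_mul.
Proof.
by elim/tens_ind => [|c a b x IH]; rewrite ?mul0r // mulPr IH tens_mulE !mul1r.
Qed.

Fact tens_mulr1 : right_id tens_one tens_mul.
Proof.
by elim/tens_ind => [|c a b x IH]; rewrite ?mul0l // mulPl IH tens_mulE !mulr1.
Qed.

Fact tens_mulDl : left_distributive tens_mul +%R.
Proof. by move=> x y z; rewrite (linD (tens_mul_linearl z)). Qed.

Fact tens_mulDr : right_distributive tens_mul +%R.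
Proof. by move=> x y z; rewrite (linD (tens_mul_linearr x)). Qed.

Fact tens_one_neq0 : tens_one != 0.
Proof.
have [phi phiL phi1] := exists_form (oner_neq0 A).
have [psi psiL psi1] := exists_form (oner_neq0 B).
pose f a b : k^o := phi a * psi b.
have fB : bilin f.
  split=> [v c u u'|u c v v']; rewrite /f ?phiL ?psiL.
    by rewrite mulrDl -scalerAl.
  by rewrite mulrDr -scalerAr.
apply/eqP => /(congr1 (tens_lift f)).
rewrite tens_liftE // (lin0 (tens_lift_linear fB)) /f phi1 psi1 mulr1.
by move/eqP; rewrite oner_eq0.
Qed.

HB.instance Definition _ := GRing.Zmodule_isNzRing.Build T
  tens_mulA tens_mul1 tens_mulr1 tens_mulDl tens_mulDr tens_one_neq0.

Fact tens_scaleAl (c : k) x y : c *: (x * y) = (c *: x) * y.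
Proof. by rewrite [RHS](linZ (tens_mul_linearl y)). Qed.
HB.instance Definition _ := GRing.Lmodule_isLalgebra.Build k T tens_scaleAl.

Fact tens_scaleAr (c : k) x y : c *: (x * y) = x * (c *: y).
Proof. by rewrite [RHS](linZ (tens_mul_linearr x)). Qed.
HB.instance Definition _ := GRing.Lalgebra_isAlgebra.Build k T tens_scaleAr.

Lemma tensM a b a' b' : (a ⊗ b) * (a' ⊗ b') = (a * a') ⊗ (b * b') :> T.
Proof. exact: tens_mulE. Qed.

Lemma tens11 : 1 ⊗ 1 = 1 :> T.
Proof. by []. Qed.

End TensorAlgebra.

Section TensorComAlgebra.
Variables (k : fieldType) (A B : comAlgType k).
Local Notation T := (A ⊗ B)%type.

Fact tens_mulC : commutative (@GRing.mul T).
Proof.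
move=> x y; elim/tens_ind: x => [|c a b x IH]; first by rewrite mul0r mulr0.
rewrite mulrDl mulrDr -scalerAl -scalerAr IH; congr (_ *: _ + _) => {x IH}.
elim/tens_ind: y => [|c' a' b' y IH]; first by rewrite mul0r mulr0.
by rewrite mulrDl mulrDr -scalerAl -scalerAr IH !tensM (mulrC a) (mulrC b).
Qed.
HB.instance Definition _ := GRing.PzRing_hasCommutativeMul.Build T tens_mulC.
HB.instance Definition _ := GRing.ComAlgebra.on T.

End TensorComAlgebra.

Section TensorMap.
Variables (k : fieldType) (U U' V V' : lmodType k).
Variables (f : {linear U -> U'}) (g : {linear V -> V'}).

Definition tens_map : U ⊗ V -> U' ⊗ V' := tens_lift (fun u v => f u ⊗ g v).

Fact tens_map_bilin : bilin (fun u v => f u ⊗ g v).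
Proof.
have [tl tr] := @tens_bilin k U' V'.
by split=> [v c u u'|u c v v']; rewrite linearP ?tl ?tr.
Qed.

Lemma tens_mapE u v : tens_map (u ⊗ v) = f u ⊗ g v.
Proof. exact/tens_liftE/tens_map_bilin. Qed.

Fact tens_map_linear : linear tens_map.
Proof. exact/tens_lift_linear/tens_map_bilin. Qed.
HB.instance Definition _ := GRing.isLinear.Build k (U ⊗ V)%type (U' ⊗ V')%type _
  tens_map tens_map_linear.

End TensorMap.

Section TensorAlgMap.
Variables (k : fieldType) (A A' B B' : algType k).
Variables (f : {lrmorphism A -> A'}) (g : {lrmorphism B -> B'}).

Fact tens_map_monoid : monoid_morphism (tens_map f g).
Proof.
have L := tens_map_linear f g; split; first by rewrite -tens11 tens_mapE !rmorph1.
move=> x y; elim/tens_ind: x => [|c a b x IH].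
  by rewrite mul0r !(lin0 L) mul0r.
rewrite mulrDl -scalerAl 2!L mulrDl -scalerAl IH; congr (_ *: _ + _) => {x IH}.
elim/tens_ind: y => [|c' a' b' y IH]; first by rewrite mulr0 !(lin0 L) mulr0.
rewrite mulrDr -scalerAr 2!L mulrDr -scalerAr IH; congr (_ *: _ + _) => {y IH}.
by rewrite tensM !tens_mapE !rmorphM tensM.
Qed.
HB.instance Definition _ := GRing.isMonoidMorphism.Build (A ⊗ B)%type (A' ⊗ B')%type
  (tens_map f g) tens_map_monoid.

End TensorAlgMap.

Section TensorIso.
Variables (k : fieldType).

(* (u ⊗ v) ⊗ w |-> u ⊗ (v ⊗ w) *)
Definition tens_assoc (U V W : lmodType k) : (U ⊗ V) ⊗ W -> U ⊗ (V ⊗ W) :=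
  tens_lift (fun t w => tens_lift (fun u v => u ⊗ (v ⊗ w)) t).

(* a ⊗ v |-> a *: v *)
Definition tens_unitl (V : lmodType k) : k^o ⊗ V -> V :=
  tens_lift (fun (a : k^o) v => (a : k) *: v).

(* v ⊗ a |-> a *: v *)
Definition tens_unitr (V : lmodType k) : V ⊗ k^o -> V :=
  tens_lift (fun v (a : k^o) => (a : k) *: v).

Section Assoc.
Variables U V W : lmodType k.

Let inner (w : W) : bilin (fun (u : U) (v : V) => u ⊗ (v ⊗ w)).
Proof.
split=> [v c u u'|u c v v']; first by rewrite (tens_bilin _ _).1.
by rewrite (tens_bilin _ _).1 (tens_bilin _ _).2.
Qed.

Fact tens_assoc_bilin :
  bilin (fun t (w : W) => tens_lift (fun (u : U) (v : V) => u ⊗ (v ⊗ w)) t).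
Proof.
split=> [w|t c w w']; first exact: tens_lift_linear.
rewrite -tens_liftP; apply: eq_tens_lift => u v.
by rewrite !(tens_bilin _ _).2.
Qed.

Lemma tens_assocE (u : U) (v : V) (w : W) :
  tens_assoc ((u ⊗ v) ⊗ w) = u ⊗ (v ⊗ w).
Proof. by rewrite /tens_assoc !tens_liftE //; exact: tens_assoc_bilin. Qed.

Fact tens_assoc_linear : linear (@tens_assoc U V W).
Proof. exact: tens_lift_linear tens_assoc_bilin. Qed.
HB.instance Definition _ := GRing.isLinear.Build k ((U ⊗ V) ⊗ W)%type
  (U ⊗ (V ⊗ W))%type _ (@tens_assoc U V W) tens_assoc_linear.

End Assoc.

Section Unit.
Variable V : lmodType k.

Fact tens_unitl_bilin : bilin (fun (a : k^o) (v : V) => (a : k) *: v).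
Proof.
split=> [v c a a'|a c v v']; first by rewrite scalerDl scalerA.
by rewrite scalerDr !scalerA mulrC.
Qed.

Fact tens_unitr_bilin : bilin (fun (v : V) (a : k^o) => (a : k) *: v).
Proof. by split; [exact: tens_unitl_bilin.2|exact: tens_unitl_bilin.1]. Qed.

Lemma tens_unitlE (a : k^o) (v : V) : tens_unitl (a ⊗ v) = (a : k) *: v.
Proof. exact: (tens_liftE _ _ tens_unitl_bilin). Qed.

Lemma tens_unitrE (v : V) (a : k^o) : tens_unitr (v ⊗ a) = (a : k) *: v.
Proof. exact: (tens_liftE _ _ tens_unitr_bilin). Qed.

Fact tens_unitl_linear : linear (@tens_unitl V).
Proof. exact: tens_lift_linear tens_unitl_bilin. Qed.
HB.instance Definition _ := GRing.isLinear.Build k (k^o ⊗ V)%type V _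
  (@tens_unitl V) tens_unitl_linear.
Fact tens_unitr_linear : linear (@tens_unitr V).
Proof. exact: tens_lift_linear tens_unitr_bilin. Qed.
HB.instance Definition _ := GRing.isLinear.Build k (V ⊗ k^o)%type V _
  (@tens_unitr V) tens_unitr_linear.

End Unit.
End TensorIso.

Section TensorAlgIso.
Variables (k : fieldType) (A B C : algType k).

Fact tens_assoc_monoid : monoid_morphism (@tens_assoc k A B C).
Proof.
split; first by rewrite -!tens11 tens_assocE.
have L := @tens_assoc_linear k A B C.
move=> x y; elim/tens_ind: x => [|c t z x IH]; first by rewrite mul0r (lin0 L) mul0r.
rewrite mulrDl -scalerAl 2!L mulrDl -scalerAl IH; congr (_ *: _ + _) => {x IH}.
elim/tens_ind: y => [|c' t' z' y IH]; first by rewrite mulr0 (lin0 L) mulr0.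
rewrite mulrDr -scalerAr 2!L mulrDr -scalerAr IH; congr (_ *: _ + _) => {y IH}.
rewrite tensM.
have tl (d : C) := (@tens_bilin k (A ⊗ B)%type C).1 d.
elim/tens_ind: t => [|d a b t IH].
  by rewrite mul0r !(lin0 (tl _)) (lin0 L) mul0r.
rewrite mulrDl -scalerAl !tl 2!L mulrDl -scalerAl IH.
congr (_ *: _ + _) => {t IH}.
elim/tens_ind: t' => [|d' a' b' t' IH].
  by rewrite mulr0 !(lin0 (tl _)) (lin0 L) mulr0.
rewrite mulrDr -scalerAr !tl 2!L mulrDr -scalerAr IH.
congr (_ *: _ + _) => {t' IH}.
by rewrite tensM !tens_assocE !tensM.
Qed.
HB.instance Definition _ := GRing.isMonoidMorphism.Build
  ((A ⊗ B) ⊗ C)%type (A ⊗ (B ⊗ C))%type (@tens_assoc k A B C) tens_assoc_monoid.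

Fact tens_unitl_monoid : monoid_morphism (@tens_unitl k A).
Proof.
have L := @tens_unitl_linear k A.
split; first by rewrite -tens11 tens_unitlE scale1r.
move=> x y; elim/tens_ind: x => [|c t z x IH]; first by rewrite mul0r (lin0 L) mul0r.
rewrite mulrDl -scalerAl 2!L mulrDl -scalerAl IH; congr (_ *: _ + _) => {x IH}.
elim/tens_ind: y => [|c' t' z' y IH]; first by rewrite mulr0 (lin0 L) mulr0.
rewrite mulrDr -scalerAr 2!L mulrDr -scalerAr IH; congr (_ *: _ + _) => {y IH}.
by rewrite tensM !tens_unitlE -scalerAl -scalerAr scalerA.
Qed.
HB.instance Definition _ := GRing.isMonoidMorphism.Build
  (k^o ⊗ A)%type A (@tens_unitl k A) tens_unitl_monoid.

Fact tens_unitr_monoid : monoid_morphism (@tens_unitr k A).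
Proof.
have L := @tens_unitr_linear k A.
split; first by rewrite -tens11 tens_unitrE scale1r.
move=> x y; elim/tens_ind: x => [|c t z x IH]; first by rewrite mul0r (lin0 L) mul0r.
rewrite mulrDl -scalerAl 2!L mulrDl -scalerAl IH; congr (_ *: _ + _) => {x IH}.
elim/tens_ind: y => [|c' t' z' y IH]; first by rewrite mulr0 (lin0 L) mulr0.
rewrite mulrDr -scalerAr 2!L mulrDr -scalerAr IH; congr (_ *: _ + _) => {y IH}.
by rewrite tensM !tens_unitrE -scalerAl -scalerAr scalerA.
Qed.
HB.instance Definition _ := GRing.isMonoidMorphism.Build
  (A ⊗ k^o)%type A (@tens_unitr k A) tens_unitr_monoid.

End TensorAlgIso.

HB.mixin Record isBialgebra (k : fieldType) A of GRing.Algebra k A := {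
  comul : {lrmorphism A -> (A ⊗ A)%type};
  counit : {lrmorphism A -> k^o};
  comulA : forall x : A,
    tens_assoc (tens_map comul idfun (comul x)) =
    tens_map idfun comul (comul x);
  counitl : forall x : A, tens_unitl (tens_map counit idfun (comul x)) = x;
  counitr : forall x : A, tens_unitr (tens_map idfun counit (comul x)) = x
}.

#[short(type="bialgType")]
HB.structure Definition Bialgebra (k : fieldType) :=
  {A of isBialgebra k A & GRing.Algebra k A}.

Record bialg_hom (k : fieldType) (A B : bialgType k) := BialgHom {
  bialg_hom_fun :> {lrmorphism A -> B};
  bialg_hom_comul : forall x,
    comul (bialg_hom_fun x) = tens_map bialg_hom_fun bialg_hom_fun (comul x);
  bialg_hom_counit : forall x, counit (bialg_hom_fun x) = counit x
}.

Lemma lrmorphism_inj (k : fieldType) (A B : algType k)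
  (f g : {lrmorphism A -> B}) : f =1 g -> f = g.
Proof.
case: f => f [[f1] [f2] [f3]]; case: g => g [[g1] [g2] [g3]] /= /funext fg.
by case: _ / fg g1 g2 g3 => g1 g2 g3; congr GRing.LRMorphism.Pack;
  congr GRing.LRMorphism.Class; f_equal; apply: Prop_irrelevance.
Qed.

Lemma bialg_homP (k : fieldType) (A B : bialgType k) (f g : bialg_hom A B) :
  f =1 g -> f = g.
Proof.
case: f g => [f f1 f2] [g g1 g2] /= /lrmorphism_inj fg.
by case: _ / fg g1 g2 => g1 g2; congr BialgHom; apply: Prop_irrelevance.
Qed.

Definition group_alg (k : fieldType) (G : groupType) : Type := {malg k[G]}.

Fact group_alg_key : unit. Proof. by []. Qed.

Section GroupAlgebra.
Variables (k : fieldType) (G : groupType).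
Local Notation kG := (group_alg k G).
Implicit Types (x y z : kG).

HB.instance Definition _ := GRing.Lmodule.on kG.

Definition group_elt : G -> kG := locked_with group_alg_key (fun s => << s >>).
Canonical group_elt_unlockable := [unlockable of group_elt].

Let group_eltE s : group_elt s = << s >>.
Proof. by rewrite unlock. Qed.

Lemma group_alg_ind (P : kG -> Prop) :
  P 0 -> (forall a s x, P x -> P (a *: group_elt s + x)) -> forall x, P x.
Proof.
move=> P0 PD; elim/malg_ind => [|a s x IH]; first exact: P0.
by rewrite -group_eltE; apply: PD.
Qed.

Definition group_one : kG := group_elt 1%g.

Definition group_mul : kG -> kG -> kG := locked_with group_alg_key (fun x y =>
  free_lift (fun s => free_lift (fun t => group_elt (s * t)%g) y) x).
Canonical group_mul_unlockable := [unlockable of group_mul].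

Let mulPl c x x' y : group_mul (c *: x + x') y = c *: group_mul x y + group_mul x' y.
Proof. by rewrite [group_mul]unlock free_lift_linear. Qed.

Let mulPr c x y y' : group_mul x (c *: y + y') = c *: group_mul x y + group_mul x y'.
Proof.
rewrite [group_mul]unlock -free_liftP; apply: eq_free_lift => s.
by rewrite free_lift_linear.
Qed.

Let mul0l y : group_mul 0 y = 0.
Proof. by have /lin0 -> // : linear (group_mul^~ y) by move=> c x x'; exact: mulPl. Qed.

Let mul0r x : group_mul x 0 = 0.
Proof. by have /lin0 -> // : linear (group_mul x) by move=> c y y'; exact: mulPr. Qed.

Lemma group_mulE s t : group_mul (group_elt s) (group_elt t) = group_elt (s * t)%g.
Proof. by rewrite [group_mul]unlock 2!group_eltE !free_liftU. Qed.

Fact group_mulA : associative group_mul.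
Proof.
move=> x y z; elim/group_alg_ind: x => [|c s x IH]; first by rewrite !mul0l.
rewrite 3!mulPl IH; congr (_ *: _ + _) => {x IH}.
elim/group_alg_ind: y => [|c' t y IH]; first by rewrite mul0l !mul0r mul0l.
rewrite mulPl 2!mulPr mulPl IH; congr (_ *: _ + _) => {y IH}.
elim/group_alg_ind: z => [|c'' u z IH]; first by rewrite !mul0r.
by rewrite 3!mulPr IH !group_mulE mulgA.
Qed.

Fact group_mul1 : left_id group_one group_mul.
Proof.
by elim/group_alg_ind => [|c s x IH]; rewrite ?mul0r // mulPr IH group_mulE mul1g.
Qed.

Fact group_mulr1 : right_id group_one group_mul.
Proof.
by elim/group_alg_ind => [|c s x IH]; rewrite ?mul0l // mulPl IH group_mulE mulg1.
Qed.

Fact group_mulDl : left_distributive group_mul +%R.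
Proof. by move=> x y z; rewrite -[x in LHS]scale1r mulPl scale1r. Qed.

Fact group_mulDr : right_distributive group_mul +%R.
Proof. by move=> x y z; rewrite -[y in LHS]scale1r mulPr scale1r. Qed.

Fact group_one_neq0 : group_one != 0.
Proof. by rewrite /group_one group_eltE monalgU_eq0 oner_eq0. Qed.

HB.instance Definition _ := GRing.Zmodule_isNzRing.Build kG
  group_mulA group_mul1 group_mulr1 group_mulDl group_mulDr group_one_neq0.

Fact group_scaleAl (c : k) x y : c *: (x * y) = (c *: x) * y.
Proof. by rewrite -[c *: x]addr0 [RHS]mulPl mul0l addr0. Qed.
HB.instance Definition _ := GRing.Lmodule_isLalgebra.Build k kG group_scaleAl.

Fact group_scaleAr (c : k) x y : c *: (x * y) = x * (c *: y).
Proof. by rewrite -[c *: y]addr0 [RHS]mulPr mul0r addr0. Qed.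
HB.instance Definition _ := GRing.Lalgebra_isAlgebra.Build k kG group_scaleAr.

Lemma group_elt1 : group_elt 1%g = 1.
Proof. by []. Qed.

Lemma group_eltM s t : group_elt (s * t)%g = group_elt s * group_elt t.
Proof. by rewrite -group_mulE. Qed.

(* The algebra morphism induced by a morphism from G to the multiplicative
   monoid of an algebra. *)
Section Lift.
Variables (A : algType k) (f : G -> A).
Hypotheses (f1 : f 1%g = 1) (fM : forall s t, f (s * t)%g = f s * f t).

Definition group_alg_lift of (f 1%g = 1) &
  (forall s t, f (s * t)%g = f s * f t) : kG -> A := free_lift f.
Local Notation F := (group_alg_lift f1 fM).

Lemma group_alg_liftE s : F (group_elt s) = f s.
Proof. by rewrite group_eltE; exact: free_liftU. Qed.

Fact group_alg_lift_linear : linear F.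
Proof. exact: free_lift_linear. Qed.

Fact group_alg_lift_monoid : monoid_morphism F.
Proof.
have L := group_alg_lift_linear.
split; first by rewrite -group_elt1 group_alg_liftE.
move=> x y; elim/group_alg_ind: x => [|c s x IH]; first by rewrite GRing.mul0r (lin0 L) GRing.mul0r.
rewrite mulrDl -scalerAl 2!L mulrDl -scalerAl IH; congr (_ *: _ + _) => {x IH}.
elim/group_alg_ind: y => [|c' t y IH]; first by rewrite mulr0 (lin0 L) mulr0.
rewrite mulrDr -scalerAr 2!L mulrDr -scalerAr IH; congr (_ *: _ + _) => {y IH}.
by rewrite -group_eltM !group_alg_liftE.
Qed.

HB.instance Definition _ := GRing.isLinear.Build k kG A _ F group_alg_lift_linear.
HB.instance Definition _ := GRing.isMonoidMorphism.Build kG A F group_alg_lift_monoid.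

End Lift.

Lemma group_alg_ext (W : lmodType k) (f g : kG -> W) : linear f -> linear g ->
  (forall s, f (group_elt s) = g (group_elt s)) -> f =1 g.
Proof.
move=> fL gL fg; elim/group_alg_ind => [|a s t IH]; first by rewrite !lin0.
by rewrite fL gL fg IH.
Qed.

Let diag (s : G) : kG ⊗ kG := group_elt s ⊗ group_elt s.

Fact group_diag1 : diag 1%g = 1.
Proof. exact: tens11. Qed.

Fact group_diagM s t : diag (s * t)%g = diag s * diag t.
Proof. by rewrite tensM -group_eltM. Qed.

Definition group_comul : {lrmorphism kG -> (kG ⊗ kG)%type} :=
  group_alg_lift group_diag1 group_diagM.

Fact group_counitM (s t : G) : (1 : k^o) = 1 * 1.
Proof. by rewrite mulr1. Qed.

Definition group_counit : {lrmorphism kG -> k^o} :=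
  @group_alg_lift k^o (fun=> 1) erefl group_counitM.

Lemma group_comulE s : group_comul (group_elt s) = group_elt s ⊗ group_elt s.
Proof. exact: group_alg_liftE. Qed.

Lemma group_counitE s : group_counit (group_elt s) = 1.
Proof. exact: group_alg_liftE. Qed.

Fact group_comulA x :
  tens_assoc (tens_map group_comul idfun (group_comul x)) =
  tens_map idfun group_comul (group_comul x).
Proof.
move: x; apply: group_alg_ext => [a x y|a x y|s]; rewrite ?linearP //.
by rewrite group_comulE !tens_mapE /= group_comulE tens_assocE.
Qed.

Fact group_counitl x : tens_unitl (tens_map group_counit idfun (group_comul x)) = x.
Proof.
move: x; apply: group_alg_ext => [a x y|//|s]; rewrite ?linearP //.
by rewrite group_comulE tens_mapE tens_unitlE /= group_counitE scale1r.
Qed.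

Fact group_counitr x : tens_unitr (tens_map idfun group_counit (group_comul x)) = x.
Proof.
move: x; apply: group_alg_ext => [a x y|//|s]; rewrite ?linearP //.
by rewrite group_comulE tens_mapE tens_unitrE /= group_counitE scale1r.
Qed.

HB.instance Definition _ := isBialgebra.Build k kG
  group_comulA group_counitl group_counitr.

End GroupAlgebra.

HB.mixin Record isLeibniz (k : fieldType) V of GRing.Lmodule k V := {
  bracket : V -> V -> V;
  bracket_linearl : forall y, linear (bracket^~ y);
  bracket_linearr : forall x, linear (bracket x);
  bracket_leibniz : forall x y z,
    bracket x (bracket y z) = bracket (bracket x y) z - bracket (bracket x z) y
}.

#[short(type="leibnizType")]
HB.structure Definition Leibniz (k : fieldType) :=
  {V of isLeibniz k V & GRing.Lmodule k V}.

#[short(type="fdLeibnizType")]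
HB.structure Definition FdLeibniz (k : fieldType) :=
  {V of isLeibniz k V & Vector k V}.

(* The first axiom says that h is the direct sum of the (possibly infinitely
   many) subspaces: every vector is, in a unique way, the sum of a finitely
   supported family of homogeneous components. *)
Record grading (k : fieldType) (G : groupType) (h : fdLeibnizType k) := Grading {
  grade :> G -> {vspace h};
  grade_decomp : forall x, exists! c : {fsfun G -> h with 0},
    (forall s, c s \in grade s) /\ x = \sum_(s <- finsupp c) c s;
  grade_bracket : forall s t x y,
    x \in grade s -> y \in grade t -> bracket x y \in grade (s * t)%g
}.


Section CoactingAlgebra.
Variables (k : fieldType) (h : fdLeibnizType k) (n : nat) (e : n.-tuple h).

(* The polynomials in the n * n variables X_(i,j), numbered by mxvec_index;
   monalg shadows the notation of mpoly for this type. *)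
Local Notation P := (mpoly.mpoly (n * n) k).

(* [e_i, e_j] = \sum_s (struct_const i j s) e_s when e is a basis of h. *)
Definition struct_const (i j s : 'I_n) : k := coord e s (bracket e`_i e`_j).
Local Notation tau := struct_const.

Definition coact_var (i j : 'I_n) : P := 'X_(mxvec_index i j).
Local Notation X := coact_var.

Definition coact_rel (a i j : 'I_n) : P :=
  \sum_(u < n) tau i j u *: X a u -
  \sum_(s < n) \sum_(t < n) tau s t a *: (X s i * X t j).

Definition coact_ideal : {pred P} := fun p => `[< exists c : 'I_n -> 'I_n -> 'I_n -> P,
  p = \sum_a \sum_i \sum_j c a i j * coact_rel a i j >].

(* Matrices over a commutative algebra that kill the relations *)
Definition coact_sol (A : comAlgType k) (v : 'I_n -> 'I_n -> A) : Prop :=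
  forall a i j, \sum_(u < n) tau i j u *: v a u =
    \sum_(s < n) \sum_(t < n) tau s t a *: (v s i * v t j).

Definition coact_eval (A : comAlgType k) (v : 'I_n -> 'I_n -> A) : P -> A :=
  mpoly.mmap (GRing.in_alg A) (fun m => mxvec (\matrix_(i, j) v i j) 0 m).

Section Eval.
Variables (A : comAlgType k) (v : 'I_n -> 'I_n -> A).

HB.instance Definition _ := GRing.RMorphism.copy (coact_eval v)
  (mpoly.mmap (GRing.in_alg A) (fun m => mxvec (\matrix_(i, j) v i j) 0 m)).

Lemma coact_evalX i j : coact_eval v (X i j) = v i j.
Proof. by rewrite /coact_eval mpoly.mmapX mpoly.mmap1U mxvecE mxE. Qed.

Fact coact_eval_scalable : scalable (coact_eval v).
Proof. by move=> c p; rewrite /coact_eval mpoly.mmapZ mulr_algl. Qed.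
HB.instance Definition _ := GRing.isScalable.Build k P A _ (coact_eval v)
  coact_eval_scalable.

Lemma coact_eval_rel a i j : coact_eval v (coact_rel a i j) =
  \sum_(u < n) tau i j u *: v a u -
    \sum_(s < n) \sum_(t < n) tau s t a *: (v s i * v t j).
Proof.
rewrite /coact_rel rmorphB !rmorph_sum /=; congr (_ - _); apply: eq_bigr => u _.
  by rewrite linearZ /= coact_evalX.
rewrite rmorph_sum /=; apply: eq_bigr => t _.
by rewrite linearZ /= rmorphM /= !coact_evalX.
Qed.

Lemma coact_eval_ideal p : coact_sol v -> p \in coact_ideal -> coact_eval v p = 0.
Proof.
move=> sol /asboolP[c ->]; rewrite rmorph_sum big1 // => a _.
rewrite rmorph_sum big1 // => i _; rewrite rmorph_sum big1 // => j _.
by rewrite rmorphM /= coact_eval_rel sol subrr mulr0.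
Qed.

End Eval.

Let delta (i j : 'I_n) : k^o := (i == j)%:R.

Fact coact_sol_delta : coact_sol delta.
Proof.
move=> a i j; rewrite (bigD1 a) //= big1 => [|u ua]; last first.
  by rewrite /delta eq_sym (negPf ua) scaler0.
rewrite (bigD1 i) //= (bigD1 j) //= !big1 => [|s si|t tj].
- by rewrite /delta !eqxx mulr1 !addr0.
- by rewrite big1 // => t _; rewrite /delta (negPf si) mul0r scaler0.
- by rewrite /delta (negPf tj) mulr0 scaler0.
Qed.

Fact coact_idealr : idealr_closed coact_ideal.
Proof.
split.
- apply/asboolP; exists (fun _ _ _ => 0); rewrite big1 // => a _.
  by rewrite big1 // => i _; rewrite big1 // => j _; rewrite mul0r.
- apply/negP => /(coact_eval_ideal coact_sol_delta)/eqP.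
  by rewrite rmorph1 oner_eq0.
move=> r p q /asboolP[c ->] /asboolP[d ->]; apply/asboolP.
exists (fun a i j => r * c a i j + d a i j).
rewrite mulr_sumr -big_split; apply: eq_bigr => a _ /=.
rewrite mulr_sumr -big_split; apply: eq_bigr => i _ /=.
rewrite mulr_sumr -big_split; apply: eq_bigr => j _ /=.
by rewrite mulrDl mulrA.
Qed.
HB.instance Definition _ := isIdealr.Build P coact_ideal coact_idealr.

Definition coact_alg : Type := {ideal_quot coact_ideal}.
HB.instance Definition _ := GRing.ComNzRing.on coact_alg.

Definition coact_proj : P -> coact_alg := \pi_({ideal_quot coact_ideal}).
HB.instance Definition _ := GRing.RMorphism.copy coact_proj
  (\pi_({ideal_quot coact_ideal}) : P -> {ideal_quot coact_ideal}).

Lemma coact_projP x : exists p, x = coact_proj p.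
Proof. by exists (repr x); rewrite /coact_proj reprK. Qed.

Lemma coact_proj_eq p q : (coact_proj p == coact_proj q) = (p - q \in coact_ideal).
Proof. by rewrite -(Quotient.idealrBE coact_ideal). Qed.

Definition coact_scale (c : k) (x : coact_alg) : coact_alg := coact_proj c%:A * x.

Fact coact_scaleA a b x : coact_scale a (coact_scale b x) = coact_scale (a * b) x.
Proof. by rewrite /coact_scale mulrA -rmorphM /= mulr_algl scalerA. Qed.
Fact coact_scale1 : left_id 1 coact_scale.
Proof. by move=> x; rewrite /coact_scale scale1r rmorph1 mul1r. Qed.
Fact coact_scaleDr : right_distributive coact_scale +%R.
Proof. by move=> c x y; rewrite /coact_scale mulrDr. Qed.
Fact coact_scaleDl x : {morph coact_scale^~ x : a b / a + b}.
Proof. by move=> a b; rewrite /coact_scale scalerDl rmorphD mulrDl. Qed.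
HB.instance Definition _ := GRing.Zmodule_isLmodule.Build k coact_alg
  coact_scaleA coact_scale1 coact_scaleDr coact_scaleDl.

Fact coact_scaleAl (c : k) (x y : coact_alg) : c *: (x * y) = (c *: x) * y.
Proof. exact: mulrA. Qed.
HB.instance Definition _ := GRing.Lmodule_isLalgebra.Build k coact_alg coact_scaleAl.
HB.instance Definition _ := GRing.Lalgebra_isComAlgebra.Build k coact_alg.

Fact coact_proj_scalable : scalable coact_proj.
Proof. by move=> c p; rewrite -mulr_algl rmorphM. Qed.
HB.instance Definition _ := GRing.isScalable.Build k P coact_alg _ coact_proj
  coact_proj_scalable.

Definition coact_gen (i j : 'I_n) : coact_alg := coact_proj (X i j).
Local Notation x_ := coact_gen.

Lemma coact_gen_sol : coact_sol (coact_gen : 'I_n -> 'I_n -> coact_alg).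
Proof.
move=> a i j; apply/eqP; rewrite -subr_eq0.
have -> : \sum_(u < n) tau i j u *: x_ a u -
    \sum_(s < n) \sum_(t < n) tau s t a *: (x_ s i * x_ t j) =
    coact_proj (coact_rel a i j).
  rewrite rmorphB !rmorph_sum /=; congr (_ - _); apply: eq_bigr => u _.
    by rewrite linearZ.
  rewrite rmorph_sum /=; apply: eq_bigr => t _.
  by rewrite linearZ /= rmorphM.
rewrite -(rmorph0 coact_proj) coact_proj_eq subr0; apply/asboolP.
exists (fun a' i' j' => ((a' == a) && (i' == i) && (j' == j))%:R).
rewrite (bigD1 a) //= (bigD1 i) //= (bigD1 j) //= !eqxx mul1r !big1 ?addr0 //.
- move=> a' /negPf na; rewrite big1 // => i' _; rewrite big1 // => j' _.
  by rewrite na mul0r.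
- by move=> i' /negPf ni; rewrite big1 // => j' _; rewrite ni mul0r.
- by move=> j' /negPf nj; rewrite nj mul0r.
Qed.

Lemma coact_alg_ind (Q : coact_alg -> Prop) :
  Q 1 -> (forall c x y, Q x -> Q y -> Q (c *: x + y)) ->
  (forall x y, Q x -> Q y -> Q (x * y)) -> (forall i j, Q (x_ i j)) ->
  forall x, Q x.
Proof.
move=> Q1 QD QM QX x; have [p ->] := coact_projP x.
have Q0 : Q 0 by rewrite -(addNr 1) -scaleN1r; apply: QD.
elim/mpolyind: p => [|c m p _ _ IH]; first by rewrite rmorph0.
rewrite rmorphD /= linearZ /=; apply: QD => // {p IH}.
rewrite mpolyXE_id rmorph_prod /=; elim/big_ind: _ => // i _.
rewrite rmorphXn /=; elim: (m i) => [|d IH]; first by rewrite expr0.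
by rewrite exprS; apply: QM => //; case/mxvec_indexP: i {IH} => i j; apply: QX.
Qed.

Section Lift.
Variables (A : comAlgType k) (v : 'I_n -> 'I_n -> A) (vP : coact_sol v).

Definition coact_lift of coact_sol v : coact_alg -> A :=
  fun x => coact_eval v (repr x).
Local Notation F := (coact_lift vP).

Let lift_proj p : F (coact_proj p) = coact_eval v p.
Proof.
apply/eqP; rewrite -subr_eq0 -rmorphB; apply/eqP/coact_eval_ideal => //.
by rewrite -coact_proj_eq /coact_proj reprK.
Qed.

Fact coact_lift_linear : linear F.
Proof.
move=> c x y; have [p ->] := coact_projP x; have [q ->] := coact_projP y.
by rewrite -linearP !lift_proj linearP.
Qed.
HB.instance Definition _ := GRing.isLinear.Build k coact_alg A _ F coact_lift_linear.

Fact coact_lift_monoid : monoid_morphism F.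
Proof.
split; first by rewrite -(rmorph1 coact_proj) lift_proj rmorph1.
move=> x y; have [p ->] := coact_projP x; have [q ->] := coact_projP y.
by rewrite -rmorphM !lift_proj rmorphM.
Qed.
HB.instance Definition _ := GRing.isMonoidMorphism.Build coact_alg A F
  coact_lift_monoid.

Lemma coact_liftE i j : F (x_ i j) = v i j.
Proof. by rewrite lift_proj coact_evalX. Qed.

End Lift.

Lemma coact_alg_ext (A : algType k) (f g : {lrmorphism coact_alg -> A}) :
  (forall i j, f (x_ i j) = g (x_ i j)) -> f =1 g.
Proof.
move=> fg; elim/coact_alg_ind => [|c x y fx fy|x y fx fy|//].
- by rewrite !rmorph1.
- by rewrite !linearP /= fx fy.
- by rewrite !rmorphM /= fx fy.
Qed.

Let comul_gen (i j : 'I_n) : coact_alg ⊗ coact_alg := \sum_(s < n) x_ i s ⊗ x_ s j.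

Fact coact_sol_comul : coact_sol (comul_gen : _ -> _ -> (coact_alg ⊗ coact_alg)%type).
Proof.
have exch4 (V : zmodType) (F : 'I_n -> 'I_n -> 'I_n -> 'I_n -> V) :
    \sum_p \sum_q \sum_s \sum_t F s t p q = \sum_s \sum_t \sum_p \sum_q F s t p q.
  rewrite pair_bigA /= exchange_big; apply: eq_bigr => s _ /=.
  rewrite exchange_big; apply: eq_bigr => t _ /=.
  by rewrite -(pair_bigA _ (fun p q => F s t p q)).
move=> a i j; transitivity (\sum_(p < n) \sum_(q < n)
   (\sum_(u < n) tau p q u *: x_ a u) ⊗ (x_ p i * x_ q j)).
  under eq_bigr => u _ do rewrite scaler_sumr.
  rewrite exchange_big /=.
  under eq_bigr => s _ do under eq_bigr => u _ do rewrite -tensZr.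
  under eq_bigr => s _ do rewrite -tens_sumr coact_gen_sol tens_sumr.
  rewrite exchange_big /=; apply: eq_bigr => p _.
  under eq_bigr => s _ do rewrite tens_sumr.
  rewrite exchange_big /=; apply: eq_bigr => q _.
  by rewrite tens_suml; apply: eq_bigr => s _; rewrite tensZl tensZr.
under eq_bigr => p _ do under eq_bigr => q _ do rewrite coact_gen_sol tens_suml.
under eq_bigr => p _ do under eq_bigr => q _ do
  under eq_bigr => s _ do rewrite tens_suml.
rewrite exch4; apply: eq_bigr => s _; apply: eq_bigr => t _.
rewrite /comul_gen mulr_suml scaler_sumr; apply: eq_bigr => p _.
rewrite mulr_sumr scaler_sumr; apply: eq_bigr => q _.
by rewrite tensM tensZl.
Qed.

Definition coact_comul : {lrmorphism coact_alg -> (coact_alg ⊗ coact_alg)%type} :=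
  coact_lift coact_sol_comul.

Definition coact_counit : {lrmorphism coact_alg -> k^o} :=
  coact_lift coact_sol_delta.

Lemma coact_comulE i j : coact_comul (x_ i j) = \sum_(s < n) x_ i s ⊗ x_ s j.
Proof. exact: coact_liftE. Qed.

Lemma coact_counitE i j : coact_counit (x_ i j) = (i == j)%:R.
Proof. exact: coact_liftE. Qed.

Fact coact_comulA x :
  tens_assoc (tens_map coact_comul idfun (coact_comul x)) =
  tens_map idfun coact_comul (coact_comul x).
Proof.
move: x; apply: (@coact_alg_ext _ (@tens_assoc k _ _ _ \o
  (tens_map coact_comul idfun \o coact_comul))
  (tens_map idfun coact_comul \o coact_comul)) => i j /=.
rewrite coact_comulE !linear_sum /=.
under eq_bigr => s _.
  rewrite tens_mapE /= coact_comulE tens_suml linear_sum /=.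
  under eq_bigr => t _ do rewrite tens_assocE.
  over.
rewrite exchange_big /=; apply: eq_bigr => t _.
by rewrite tens_mapE /= coact_comulE tens_sumr.
Qed.

Fact coact_counitl x : tens_unitl (tens_map coact_counit idfun (coact_comul x)) = x.
Proof.
move: x; apply: (@coact_alg_ext _ (@tens_unitl k _ \o
  (tens_map coact_counit idfun \o coact_comul)) idfun) => i j /=.
rewrite coact_comulE !linear_sum /= (bigD1 i) //= big1 => [|s si].
  by rewrite tens_mapE tens_unitlE /= coact_counitE eqxx scale1r addr0.
by rewrite tens_mapE tens_unitlE /= coact_counitE eq_sym (negPf si) scale0r.
Qed.

Fact coact_counitr x : tens_unitr (tens_map idfun coact_counit (coact_comul x)) = x.
Proof.
move: x; apply: (@coact_alg_ext _ (@tens_unitr k _ \o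
  (tens_map idfun coact_counit \o coact_comul)) idfun) => i j /=.
rewrite coact_comulE !linear_sum /= (bigD1 j) //= big1 => [|s sj].
  by rewrite tens_mapE tens_unitrE /= coact_counitE eqxx scale1r addr0.
by rewrite tens_mapE tens_unitrE /= coact_counitE (negPf sj) scale0r.
Qed.

HB.instance Definition _ := isBialgebra.Build k coact_alg
  coact_comulA coact_counitl coact_counitr.

(* The coaction, determined by e_i |-> \sum_s e_s ⊗ x_(s,i) when e is a basis
   of h *)
Definition coaction (x : h) : h ⊗ coact_alg :=
  \sum_(i < n) coord e i x *: \sum_(s < n) e`_s ⊗ x_ s i.

Fact coaction_linear : linear coaction.
Proof.
move=> c x y; rewrite /coaction scaler_sumr -big_split; apply: eq_bigr => i _ /=.
by rewrite linearP scalerDl scalerA.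
Qed.
HB.instance Definition _ := GRing.isLinear.Build k h (h ⊗ coact_alg)%type _
  coaction coaction_linear.

Lemma coactionE (i : 'I_n) : basis_of fullv e ->
  coaction e`_i = \sum_(s < n) e`_s ⊗ x_ s i.
Proof.
move=> /basis_free efree; rewrite /coaction (bigD1 i) //= coord_free // eqxx.
rewrite scale1r [X in _ + X]big1 ?addr0 // => j ji.
by rewrite coord_free // eq_sym (negPf ji) scale0r.
Qed.

End CoactingAlgebra.

(* Main.v *)
(** A bialgebra morphism [theta] is encoded by the matrix [v i j = theta x_ij]
over [k[G]]; it acts on coordinates by [R_a x = \sum_i x_i v a i], and the
condition [(id ⊗ theta) (eta x) = x ⊗ s] reads [R_a x = x_a s] for all [a].
Compatibility of [theta] with the comultiplication and the counit makes the
maps sending [x] to the coefficients of [s] in the [R_a x] a complete family of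
orthogonal projections, whose images are the homogeneous spaces; the relations
of the coacting algebra say that these form a Leibniz algebra grading.
Conversely a grading with components [x = \sum_s c_s x] yields the matrix
[v a i = \sum_s (c_s e_i)_a s]; all the identities required of it are
(multi)linear in elements of [h], so they need only be checked on homogeneous
ones. *)

Require Import Defs.
From HB Require Import structures.
From mathcomp Require Import all_boot all_order all_algebra finmap.
From mathcomp Require Import boolp.
From mathcomp Require monalg.

Set Implicit Arguments.
Unset Strict Implicit.
Unset Printing Implicit Defensive.

Import GRing.Theory.
Local Open Scope ring_scope.

(** * Sums under linear maps and over finite supports *)

Lemma lin_sum (k : fieldType) (V W : lmodType k) (f : V -> W) (fL : linear f)
    (I : Type) (r : seq I) (F : I -> V) :
  f (\sum_(i <- r) F i) = \sum_(i <- r) f (F i).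
Proof. exact: (big_morph f (linD fL) (lin0 fL)). Qed.

(** Indices outside the support contribute [F s 0], which vanishes. Families with different supports
    can thus be summed over a common finite set. *)
Lemma sum_finsupp (G : choiceType) (V W : zmodType) (c : {fsfun G -> V with 0})
    (S : {fset G}) (F : G -> V -> W) :
  (forall s, F s 0 = 0) -> (finsupp c `<=` S)%fset ->
  \sum_(s <- finsupp c) F s (c s) = \sum_(s <- S) F s (c s).
Proof.
move=> F0 cS; rewrite (big_fset_incl _ cS) //= => s _ /fsfun_dflt ->.
exact: F0.
Qed.

(** * Coefficients in the group algebra *)

Section GroupAlgCoef.
Variables (k : fieldType) (G : groupType).
Local Notation kG := (group_alg k G).

Definition group_coef (s : G) (x : kG) : k := monalg.mcoeff s x.

Lemma group_coef_linear s : scalar (group_coef s).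
Proof. by move=> a x y; rewrite /group_coef monalg.mcoeffD monalg.mcoeffZ. Qed.
HB.instance Definition _ s := GRing.isLinear.Build k kG k *%R (group_coef s)
  (group_coef_linear s).

Lemma group_coef_elt s t : group_coef s (group_elt k t) = (t == s)%:R.
Proof. by rewrite /group_coef [@group_elt k G]unlock monalg.mcoeffU. Qed.

Lemma group_coefP (x y : kG) : (forall s, group_coef s x = group_coef s y) -> x = y.
Proof. by move=> xy; apply/monalg.malgP. Qed.

Lemma group_coef_sum (S : {fset G}) (c : G -> k) s : (s \notin S -> c s = 0) ->
  group_coef s (\sum_(t <- S) c t *: group_elt k t) = c s.
Proof.
move=> cS; rewrite linear_sum /=.
under eq_bigr => t _ do rewrite linearZ /= group_coef_elt.
have [sS|/cS c0] := boolP (s \in S).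
  rewrite (big_fsetD1 s) //= eqxx big1_fset ?addr0 ?mulr1 // => t.
  by rewrite !inE => /andP[/negPf -> _]; rewrite mulr0.
rewrite c0 big1_fset // => t _ _; case: eqVneq => [->|_]; last by rewrite mulr0.
by rewrite c0 mul0r.
Qed.

Lemma group_algE (x : kG) (S : {fset G}) : (monalg.msupp x `<=` S)%fset ->
  x = \sum_(s <- S) group_coef s x *: group_elt k s.
Proof.
move=> xS; apply: group_coefP => s; rewrite group_coef_sum // => sS.
by apply: monalg.mcoeff_outdom; apply: contra sS; apply: (fsubsetP xS).
Qed.

(** The map [id ⊗ group_coef s], composed with the identification of [kG ⊗ k] with [kG]. *)
Definition tens_coef s : (kG ⊗ kG)%type -> kG :=
  tens_lift (fun x y => group_coef s y *: x).

Lemma tens_coef_bilin s : bilin (fun x y : kG => group_coef s y *: x).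
Proof.
split=> [y c x x'|x c y y']; first by rewrite scalerDr !scalerA mulrC.
by rewrite linearP scalerDl scalerA.
Qed.

Lemma tens_coef_linear s : linear (tens_coef s).
Proof. exact/tens_lift_linear/tens_coef_bilin. Qed.
HB.instance Definition _ s := GRing.isLinear.Build k (kG ⊗ kG)%type kG _
  (tens_coef s) (tens_coef_linear s).

Lemma tens_coefE s x y : tens_coef s (x ⊗ y) = group_coef s y *: x.
Proof. exact/tens_liftE/tens_coef_bilin. Qed.

Lemma linear_comul : linear (comul : kG -> (kG ⊗ kG)%type).
Proof. exact: linearP. Qed.

(** Both sides are linear in [x], and on a group element [t] the comultiplication is [t ⊗ t]. *)
Lemma tens_coef_comul s x :
  tens_coef s (comul x) = group_coef s x *: group_elt k s.
Proof.
move: x; apply: group_alg_ext => [a x y|a x y|t].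
- by rewrite (linear_comul a) tens_coef_linear.
- by rewrite group_coef_linear scalerDl scalerA.
rewrite [comul _]group_comulE tens_coefE group_coef_elt.
by case: eqVneq => [->|_]; rewrite ?scale1r ?scale0r.
Qed.

Lemma group_alg_mulC : (forall s t : G, (s * t = t * s)%g) ->
  commutative (@GRing.mul kG).
Proof.
move=> GC x y.
have mulL z : linear (fun w : kG => w * z).
  by move=> c w w'; rewrite [LHS]mulrDl [c *: (w * z)]scalerAl.
have mulR z : linear (fun w : kG => z * w).
  by move=> c w w'; rewrite [LHS]mulrDr [c *: (z * w)]scalerAr.
move: x; apply: group_alg_ext => // s; move: y; apply: group_alg_ext => // t.
by rewrite -(group_eltM k s t) -(group_eltM k t s) GC.
Qed.

End GroupAlgCoef.

(** * Morphisms out of the coacting algebra, and coordinates in a basis *)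

Section Coacting.
Variables (k : fieldType) (h : fdLeibnizType k) (n : nat) (e : n.-tuple h).
Local Notation A := (coact_alg e).

(* This is [coact_sol] without the requirement that the algebra carry a
   commutative structure, which [group_alg] does not. *)
Definition struct_const_compat (B : algType k) (v : 'I_n -> 'I_n -> B) : Prop :=
  forall a i j, \sum_(u < n) struct_const e i j u *: v a u =
    \sum_(s < n) \sum_(t < n) struct_const e s t a *: (v s i * v t j).

Lemma coact_lift_exists (B : algType k) (v : 'I_n -> 'I_n -> B) :
  commutative (@GRing.mul B) ->
  struct_const_compat v ->
  exists f : {lrmorphism A -> B}, forall i j, f (coact_gen e i j) = v i j.
Proof.
move=> mulC vP.
(* [C] is [B] repackaged with the commutativity given by [mulC], so that the universal property
   [coact_lift] applies to it. *)
pose C : comAlgType k := HB.pack (GRing.Algebra.sort B)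
  (GRing.PzRing_hasCommutativeMul.Build B mulC).
pose w : 'I_n -> 'I_n -> C := v.
have wP : coact_sol e w by exact: vP.
exists (coact_lift wP : {lrmorphism A -> C}) => i j.
exact: (coact_liftE wP i j).
Qed.

Section Basis.
Hypothesis e_basis : basis_of fullv e.

Lemma coordE x : x = \sum_(i < n) coord e i x *: e`_i.
Proof. exact: (coord_basis e_basis (memvf x)). Qed.

Lemma coord_inj x y : (forall i, coord e i x = coord e i y) -> x = y.
Proof. by move=> xy; rewrite [x]coordE [y]coordE; apply: eq_bigr => i _; rewrite xy. Qed.

Lemma coord_nth i j : coord e i e`_(j : 'I_n) = (i == j)%:R.
Proof. by rewrite coord_free ?(basis_free e_basis) // eq_sym. Qed.

Lemma coord_comb (c : 'I_n -> k) i : coord e i (\sum_(j < n) c j *: e`_j) = c i.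
Proof. by rewrite coord_sum_free ?(basis_free e_basis). Qed.

Lemma coord_bracket a x y : coord e a (bracket x y) =
  \sum_(s < n) \sum_(t < n) coord e s x * coord e t y * struct_const e s t a.
Proof.
rewrite {1}[x]coordE (lin_sum (bracket_linearl y)) linear_sum.
apply: eq_bigr => s _; rewrite (linZ (bracket_linearl y)).
rewrite {1}[y]coordE (lin_sum (bracket_linearr _)) scaler_sumr linear_sum.
by apply: eq_bigr => t _; rewrite (linZ (bracket_linearr _)) !linearZ /= mulrA.
Qed.

Section Hom.
Variables (B : lmodType k) (v : 'I_n -> 'I_n -> B).

(* The [a]-th coordinate of the image of [x] under the linear map
   [e_i |-> \sum_a e_a ⊗ v a i] into [h ⊗ B]. *)
Definition coact_coord a (x : h) : B := \sum_(i < n) coord e i x *: v a i.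

Lemma coact_coord_linear a : linear (coact_coord a).
Proof.
move=> c x y; rewrite /coact_coord scaler_sumr -big_split.
by apply: eq_bigr => i _ /=; rewrite linearP scalerDl scalerA.
Qed.
HB.instance Definition _ a := GRing.isLinear.Build k h B _ (coact_coord a)
  (coact_coord_linear a).

Lemma coact_coord_nth a i : coact_coord a e`_(i : 'I_n) = v a i.
Proof.
rewrite /coact_coord (bigD1 i) //= coord_nth eqxx scale1r big1 ?addr0 // => j ji.
by rewrite coord_nth (negPf ji) scale0r.
Qed.

End Hom.

(** Contraction of the first factor with the [a]-th coordinate form. It recovers [b_a] from
    [\sum_a e_a ⊗ b_a]. *)
Definition tens_coord (B : lmodType k) a : (h ⊗ B)%type -> B :=
  tens_lift (fun x b => coord e a x *: b).

Lemma tens_coord_bilin (B : lmodType k) a :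
  bilin (fun (x : h) (b : B) => coord e a x *: b).
Proof.
split=> [b c x x'|x c b b']; first by rewrite linearP scalerDl scalerA.
by rewrite scalerDr !scalerA mulrC.
Qed.

Lemma tens_coord_linear (B : lmodType k) a : linear (@tens_coord B a).
Proof. exact/tens_lift_linear/tens_coord_bilin. Qed.

Lemma tens_coordE (B : lmodType k) a x (b : B) :
  tens_coord a (x ⊗ b) = coord e a x *: b.
Proof. exact/tens_liftE/tens_coord_bilin. Qed.

Lemma tens_map_coaction (B : algType k) (f : {lrmorphism A -> B}) x :
  tens_map idfun f (coaction e x) =
  \sum_(a < n) e`_a ⊗ coact_coord (fun i j => f (coact_gen e i j)) a x.
Proof.
rewrite linear_sum /=.
under eq_bigr => i _ do rewrite linearZ /= linear_sum scaler_sumr.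
rewrite exchange_big; apply: eq_bigr => a _ /=; rewrite tens_sumr.
by apply: eq_bigr => i _; rewrite tens_mapE tensZr.
Qed.

Lemma tens_map_coaction_eq (B : algType k) (f : {lrmorphism A -> B}) x b :
  tens_map idfun f (coaction e x) = x ⊗ b <->
  forall a, coact_coord (fun i j => f (coact_gen e i j)) a x = coord e a x *: b.
Proof.
rewrite tens_map_coaction; split=> [+ a|H].
  move/(congr1 (@tens_coord B a)); rewrite tens_coordE => <-.
  rewrite (lin_sum (@tens_coord_linear B a)) (bigD1 a) //= tens_coordE coord_nth.
  rewrite eqxx scale1r big1 ?addr0 // => i ia.
  by rewrite tens_coordE coord_nth eq_sym (negPf ia) scale0r.
rewrite [x in RHS]coordE tens_suml; apply: eq_bigr => a _.
by rewrite H tensZr tensZl.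
Qed.

End Basis.
End Coacting.

(** * Homogeneous components of a vector in a graded algebra *)

Section GradingComponents.
Variables (k : fieldType) (G : groupType) (h : fdLeibnizType k).

Lemma gradingP (g g' : grading G h) : (forall s x, x \in g s <-> x \in g' s) -> g = g'.
Proof.
case: g g' => [g gD gB] [g' gD' gB'] /= gg'.
have {gg'} gg' : g = g'.
  by apply/funext => s; apply/vspaceP => x; apply/idP/idP => /gg'.
by case: _ / gg' gD' gB' => gD' gB'; congr Grading; apply: Prop_irrelevance.
Qed.

Variable g : grading G h.

Definition grading_comp (x : h) : {fsfun G -> h with 0} := sval (cid (grade_decomp g x)).
Local Notation comp := grading_comp.

Lemma grading_comp_mem x s : comp x s \in g s.
Proof. by rewrite /comp; case: cid => c [[]]. Qed.

Lemma grading_comp_sum x : x = \sum_(s <- finsupp (comp x)) comp x s.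
Proof. by rewrite /comp; case: cid => c [[]]. Qed.

(** Uniqueness of the decomposition, stated for a plain function vanishing outside [S], so that
    candidate components can be given by formulas. *)
Lemma grading_comp_uniq x (S : {fset G}) (d : G -> h) :
  (forall s, d s \in g s) -> (forall s, s \notin S -> d s = 0) ->
  x = \sum_(s <- S) d s -> forall s, comp x s = d s.
Proof.
move=> dg dS xE; pose c : {fsfun G -> h with 0} := [fsfun s in S => d s].
have cE s : c s = d s by rewrite fsfunE; case: ifPn => // /dS.
suff -> : comp x = c by [].
rewrite /comp; case: cid => c' [_ uc] /=; apply: uc; split=> [s|].
  by rewrite cE.
rewrite xE (@sum_finsupp _ _ _ c S (fun=> id)) //.
  by apply: eq_bigr => s _; rewrite cE.
by apply/fsubsetP => s; rewrite mem_finsupp cE; apply: contraR => /dS ->.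
Qed.

Lemma grading_comp_homog s x t : x \in g s ->
  comp x t = if t == s then x else 0.
Proof.
move=> xs; apply: (@grading_comp_uniq x [fset s]%fset (fun t => if t == s then x else 0)).
- by move=> u; case: eqP => [->|_] //; exact: mem0v.
- by move=> u; rewrite inE => /negPf ->.
- by rewrite big_seq_fset1 eqxx.
Qed.

(** The combination of the components of [x] and [y] is a homogeneous decomposition of [a *: x + y],
    hence the only one. *)
Lemma grading_comp_linear s : linear (comp^~ s).
Proof.
move=> a x y; pose S := (finsupp (comp x) `|` finsupp (comp y))%fset.
apply: (@grading_comp_uniq _ S (fun s => a *: comp x s + comp y s)).
- by move=> t; rewrite memvD ?memvZ ?grading_comp_mem.
- move=> t; rewrite !inE negb_or => /andP[tx ty].
  by rewrite !fsfun_dflt // scaler0 addr0.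
rewrite {1}[x]grading_comp_sum {1}[y]grading_comp_sum big_split -scaler_sumr /=.
by rewrite !(@sum_finsupp _ _ _ _ S (fun=> id)) ?fsubsetUl ?fsubsetUr.
Qed.

Lemma grading_linear_ext (W : lmodType k) (f f' : h -> W) :
  linear f -> linear f' ->
  (forall s x, x \in g s -> f x = f' x) -> f =1 f'.
Proof.
move=> fL f'L ff' x; rewrite [x]grading_comp_sum !lin_sum //.
by apply: eq_bigr => s _; apply: (ff' s); exact: grading_comp_mem.
Qed.

End GradingComponents.

(** * Bialgebra morphisms from matrices over the group algebra *)

Section Correspondence.
Variables (k : fieldType) (G : groupType).
Variables (h : fdLeibnizType k) (n : nat) (e : n.-tuple h).
Hypothesis e_basis : basis_of fullv e.
Local Notation A := (coact_alg e).
Local Notation kG := (group_alg k G).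

(** Compatibility with [comul] and [counit] equates algebra morphisms, so it is enough to check it
    on the generators. *)
Lemma bialg_hom_exists (v : 'I_n -> 'I_n -> kG) :
  (forall s t : G, (s * t = t * s)%g) ->
  struct_const_compat e v ->
  (forall i j, comul (v i j) = \sum_(l < n) v i l ⊗ v l j) ->
  (forall i j, counit (v i j) = (i == j)%:R) ->
  exists theta : bialg_hom A kG, forall i j, theta (coact_gen e i j) = v i j.
Proof.
move=> GC vM vD vE.
have [f fE] := coact_lift_exists (group_alg_mulC (k := k) GC) vM.
have fD x : comul (f x) = tens_map f f (comul x).
  move: x; apply: (@coact_alg_ext _ _ _ _ _ (comul \o f) (tens_map f f \o comul)).
  move=> i j /=; rewrite fE vD [comul (coact_gen e i j)]coact_comulE linear_sum /=.
  by apply: eq_bigr => l _; rewrite tens_mapE /= !fE.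
have fe x : counit (f x) = counit x.
  move: x; apply: (@coact_alg_ext _ _ _ _ _ (counit \o f) counit) => i j /=.
  by rewrite fE vE [RHS]coact_counitE.
by exists (BialgHom fD fe).
Qed.

(** * From a matrix over the group algebra to a grading *)

Section HomToGrading.
Variable v : 'I_n -> 'I_n -> kG.
Hypothesis v_mul : struct_const_compat e v.
Hypothesis v_comul : forall i j, comul (v i j) = \sum_(l < n) v i l ⊗ v l j.
Hypothesis v_counit : forall i j, counit (v i j) = (i == j)%:R.
Local Notation R := (coact_coord e v).

Definition homog (s : G) (x : h) : Prop :=
  forall a, R a x = coord e a x *: group_elt k s.

Lemma coact_coord_comul a x : comul (R a x) = \sum_(l < n) v a l ⊗ R l x.
Proof.
rewrite (lin_sum (@linear_comul k G)).
under eq_bigr => i _ do rewrite (linZ (@linear_comul k G)) v_comul scaler_sumr.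
rewrite exchange_big; apply: eq_bigr => l _ /=; rewrite tens_sumr.
by apply: eq_bigr => i _; rewrite tensZr.
Qed.

Lemma coact_coord_counit a x : counit (R a x) = coord e a x.
Proof.
rewrite linear_sum (bigD1 a) //= linearZ /= v_counit eqxx big1 ?addr0.
  by rewrite [LHS]mulr1.
by move=> i ia; rewrite linearZ /= v_counit eq_sym (negPf ia) scaler0.
Qed.

(** The projection onto degree [s]: take the coefficient of [s] in each coordinate of the
    coaction. *)
Definition homog_comp (s : G) (x : h) : h :=
  \sum_(a < n) group_coef s (R a x) *: e`_a.

Lemma homog_comp_linear s : linear (homog_comp s).
Proof.
move=> c x y; rewrite /homog_comp scaler_sumr -big_split; apply: eq_bigr => a _ /=.
by rewrite coact_coord_linear group_coef_linear scalerDl scalerA.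
Qed.
HB.instance Definition _ s := GRing.isLinear.Build k h h _ (homog_comp s)
  (homog_comp_linear s).

Lemma coord_homog_comp s x a : coord e a (homog_comp s x) = group_coef s (R a x).
Proof. exact: (coord_comb e_basis). Qed.

(* Apply [id ⊗ group_coef s] to [coact_coord_comul]. *)
Lemma homog_compP s x : homog s (homog_comp s x).
Proof.
move=> a; rewrite coord_homog_comp -tens_coef_comul coact_coord_comul.
rewrite (lin_sum (@tens_coef_linear k G s)); apply: eq_bigr => l _.
by rewrite coord_homog_comp tens_coefE.
Qed.

(** With [homog_compP], this makes the maps [homog_comp s] orthogonal idempotents. *)
Lemma homog_comp_id s t x : homog s x -> homog_comp t x = if t == s then x else 0.
Proof.
move=> xs; apply: (coord_inj e_basis) => a; rewrite coord_homog_comp xs.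
rewrite linearZ /= group_coef_elt eq_sym.
by case: eqVneq => _; rewrite ?linear0 ?mulr1 ?mulr0.
Qed.

(** The image of an idempotent is its fixed space; this form turns the predicate [homog s] into a
    [{vspace h}]. *)
Definition homog_space (s : G) : {vspace h} := fixedSpace (linfun (homog_comp s)).

Lemma homog_spaceP s x : x \in homog_space s <-> homog s x.
Proof.
split=> [/fixedSpaceP|xs]; first by rewrite lfunE /= => <-; exact: homog_compP.
by apply/fixedSpaceP; rewrite lfunE /= (homog_comp_id _ xs) eqxx.
Qed.

Definition homog_supp (x : h) : {fset G} :=
  \big[fsetU/fset0]_(a < n) monalg.msupp (R a x).

Lemma homog_supp_sub a x : (monalg.msupp (R a x) `<=` homog_supp x)%fset.
Proof. exact: (bigfcup_sup _ (mem_index_enum a)). Qed.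

Lemma homog_comp_supp s x : s \notin homog_supp x -> homog_comp s x = 0.
Proof.
move=> sx; apply: (coord_inj e_basis) => a; rewrite coord_homog_comp linear0.
apply: monalg.mcoeff_outdom; apply: contra sx.
exact: (fsubsetP (homog_supp_sub a x)).
Qed.

(** The counit of [R a x] is the sum of its coefficients, since group elements have counit 1; by
    [v_counit] it is also the [a]-th coordinate of [x]. *)
Lemma homog_comp_sum x : x = \sum_(s <- homog_supp x) homog_comp s x.
Proof.
apply: (coord_inj e_basis) => a; rewrite linear_sum /= -[LHS]coact_coord_counit.
rewrite {1}[R a x](group_algE (homog_supp_sub a x)) linear_sum; apply: eq_bigr => s _.
by rewrite linearZ /= [counit _]group_counitE coord_homog_comp [LHS]mulr1.
Qed.

Lemma homog_decomp x : exists! c : {fsfun G -> h with 0},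
  (forall s, c s \in homog_space s) /\ x = \sum_(s <- finsupp c) c s.
Proof.
pose c : {fsfun G -> h with 0} := [fsfun s in homog_supp x => homog_comp s x].
have cE s : c s = homog_comp s x by rewrite fsfunE; case: ifPn => // /homog_comp_supp.
exists c; split; first split.
- by move=> s; rewrite cE; apply/homog_spaceP; exact: homog_compP.
- rewrite (@sum_finsupp _ _ _ c (homog_supp x) (fun=> id)) //.
    by under eq_bigr => s _ do rewrite cE; exact: homog_comp_sum.
  apply/fsubsetP => s; rewrite mem_finsupp cE; apply: contraR => sx.
  by rewrite homog_comp_supp.
(* Uniqueness: applying [homog_comp t] to [x = \sum_s d s] kills every term except [d t]. *)
move=> d [dh xE]; apply/fsfunP => t; rewrite cE [x in LHS]xE linear_sum.
under eq_bigr => s _ do rewrite /= (homog_comp_id t ((homog_spaceP _ _).1 (dh s))).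
have [td|td] := boolP (t \in finsupp d).
  rewrite (big_fsetD1 t) //= eqxx big1_fset ?addr0 // => s.
  by rewrite !inE eq_sym => /andP[/negPf -> _].
rewrite fsfun_dflt // big1_fset // => s sd _; case: eqP => // ts.
by rewrite -ts (negPf td) in sd.
Qed.

(** This extends [v_mul] from basis vectors by bilinearity: after expansion in coordinates,
    exchanging sums regroups the [v s i] into [R s x] and the [v t j] into [R t y]. *)
Lemma coact_coord_bracket a x y : R a (bracket x y) =
  \sum_(s < n) \sum_(t < n) struct_const e s t a *: (R s x * R t y).
Proof.
have RL := @coact_coord_linear _ _ _ e _ v a.
transitivity (\sum_(i < n) \sum_(j < n) (coord e i x * coord e j y) *:
    \sum_(s < n) \sum_(t < n) struct_const e s t a *: (v s i * v t j)).
  rewrite {1}/coact_coord.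
  under eq_bigr => u _ do rewrite (coord_bracket e_basis) scaler_suml.
  rewrite exchange_big; apply: eq_bigr => i _ /=.
  under eq_bigr => u _ do rewrite scaler_suml.
  rewrite exchange_big; apply: eq_bigr => j _ /=.
  by rewrite -v_mul scaler_sumr; apply: eq_bigr => u _; rewrite scalerA.
under eq_bigr => i _ do under eq_bigr => j _ do rewrite scaler_sumr.
under eq_bigr => i _ do rewrite exchange_big.
rewrite exchange_big; apply: eq_bigr => s _ /=.
under eq_bigr => i _ do under eq_bigr => j _ do rewrite scaler_sumr.
under eq_bigr => i _ do rewrite exchange_big.
rewrite exchange_big; apply: eq_bigr => t _ /=.
rewrite {1}/coact_coord mulr_suml scaler_sumr; apply: eq_bigr => i _.
rewrite /coact_coord mulr_sumr scaler_sumr; apply: eq_bigr => j _.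
by rewrite -scalerAl -scalerAr !scalerA mulrC mulrA.
Qed.

Lemma homog_bracket s t x y : homog s x -> homog t y -> homog (s * t)%g (bracket x y).
Proof.
move=> xs yt a; rewrite coact_coord_bracket (coord_bracket e_basis) scaler_suml.
apply: eq_bigr => i _; rewrite scaler_suml; apply: eq_bigr => j _.
rewrite xs yt -scalerAl -scalerAr !scalerA group_eltM; congr (_ *: _).
by rewrite -mulrA mulrC.
Qed.

Lemma homog_space_bracket s t x y : x \in homog_space s -> y \in homog_space t ->
  bracket x y \in homog_space (s * t)%g.
Proof.
by move=> /homog_spaceP xs /homog_spaceP yt; apply/homog_spaceP/homog_bracket.
Qed.

Definition grading_of_mx : grading G h := Grading homog_decomp homog_space_bracket.

End HomToGrading.

(** * From a grading to a matrix over the group algebra *)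

Section GradingToHom.
Variable g : grading G h.

(** The [a]-th coordinate of [\sum_s x_s ⊗ s], where [x_s] is the component of [x] of degree [s]. *)
Definition degree_coord (a : 'I_n) (x : h) : kG :=
  \sum_(s <- finsupp (grading_comp g x))
    coord e a (grading_comp g x s) *: group_elt k s.
Local Notation D := degree_coord.

Lemma group_coef_degree_coord a x s :
  group_coef s (D a x) = coord e a (grading_comp g x s).
Proof.
rewrite (group_coef_sum (c := fun s => coord e a (grading_comp g x s))) // => sx.
by rewrite fsfun_dflt // linear0.
Qed.

Lemma degree_coord_linear a : linear (D a).
Proof.
move=> c x y; apply: group_coefP => s.
by rewrite group_coef_linear !group_coef_degree_coord grading_comp_linear linearP.
Qed.

Lemma degree_coordP s x :
  x \in g s <-> forall a, D a x = coord e a x *: group_elt k s.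
Proof.
split=> [xs a|xs].
  apply: group_coefP => t; rewrite group_coef_degree_coord (grading_comp_homog _ xs).
  rewrite linearZ /= group_coef_elt eq_sym.
  by case: eqVneq => _; rewrite ?linear0 ?mulr1 ?mulr0.
(* Comparing coefficients of [s] shows that [x] and its component of degree [s] have the same
   coordinates. *)
suff -> : x = grading_comp g x s by exact: grading_comp_mem.
apply: (coord_inj e_basis) => a; rewrite -group_coef_degree_coord xs linearZ /=.
by rewrite group_coef_elt eqxx mulr1.
Qed.

Definition degree_mx (i j : 'I_n) : kG := D i e`_j.

Lemma coact_coord_degree a x : coact_coord e degree_mx a x = D a x.
Proof.
rewrite [x in RHS](coordE e_basis) (lin_sum (degree_coord_linear a)).
by apply: eq_bigr => i _; rewrite (linZ (degree_coord_linear a)).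
Qed.

Lemma degree_coord_bracket a x y : D a (bracket x y) =
  \sum_(s < n) \sum_(t < n) struct_const e s t a *: (D s x * D t y).
Proof.
pose F x y := \sum_(s < n) \sum_(t < n) struct_const e s t a *: (D s x * D t y).
have FL z : linear (F^~ z).
  move=> c u w; rewrite /F scaler_sumr -big_split; apply: eq_bigr => s _ /=.
  rewrite scaler_sumr -big_split; apply: eq_bigr => t _ /=.
  by rewrite degree_coord_linear mulrDl scalerDr -scalerAl !scalerA mulrC.
have FR z : linear (F z).
  move=> c u w; rewrite /F scaler_sumr -big_split; apply: eq_bigr => s _ /=.
  rewrite scaler_sumr -big_split; apply: eq_bigr => t _ /=.
  by rewrite degree_coord_linear mulrDr scalerDr -scalerAr !scalerA mulrC.
have DL := degree_coord_linear a.
rewrite -/(F x y); move: x; apply: (grading_linear_ext (g := g)) => [c u w|//|s x xs].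
  by rewrite (bracket_linearl y) DL.
move: y; apply: (grading_linear_ext (g := g)) => [c u w|//|t y yt].
  by rewrite (bracket_linearr x) DL.
rewrite ((degree_coordP _ _).1 (grade_bracket xs yt)) /F.
rewrite (coord_bracket e_basis) scaler_suml; apply: eq_bigr => i _.
rewrite scaler_suml; apply: eq_bigr => j _.
rewrite ((degree_coordP _ _).1 xs) ((degree_coordP _ _).1 yt).
rewrite -scalerAl -scalerAr !scalerA group_eltM; congr (_ *: _).
by rewrite mulrC mulrA.
Qed.

Lemma degree_mx_mul : struct_const_compat e degree_mx.
Proof. by move=> a i j; rewrite -degree_coord_bracket -coact_coord_degree. Qed.

Lemma degree_mx_comul i j :
  comul (degree_mx i j) = \sum_(l < n) degree_mx i l ⊗ degree_mx l j.
Proof.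
(* Basis vectors need not be homogeneous. Replacing [e_j] by an arbitrary vector gives a linear
   identity that can be checked on homogeneous ones. *)
rewrite /degree_mx; move: e`_j.
have [tl tr] := @tens_bilin k kG kG.
apply: (grading_linear_ext (g := g)) => [c u w|c u w|s x xs].
- by rewrite degree_coord_linear linear_comul.
- rewrite scaler_sumr -big_split; apply: eq_bigr => l _ /=.
  by rewrite degree_coord_linear tr.
rewrite ((degree_coordP _ _).1 xs) (linZ (@linear_comul k G)).
(* For [x] of degree [s] the left side is [D i x ⊗ s]; expanding [D i x] along the basis gives the
   sum over [l]. *)
rewrite [comul _]group_comulE -tensZl -((degree_coordP _ _).1 xs).
rewrite -coact_coord_degree tens_suml; apply: eq_bigr => l _.
by rewrite ((degree_coordP _ _).1 xs) tensZl tensZr.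
Qed.

Lemma degree_mx_counit i j : counit (degree_mx i j) = (i == j)%:R.
Proof.
rewrite -(coord_nth e_basis) /degree_mx; move: e`_j.
apply: (@grading_linear_ext _ _ _ g k^o) => [c u w|c u w|s x xs].
- by rewrite degree_coord_linear linearP.
- by rewrite linearP.
by rewrite ((degree_coordP _ _).1 xs) linearZ /= [counit _]group_counitE [LHS]mulr1.
Qed.

End GradingToHom.

(** * The grading of a bialgebra morphism, and bijectivity *)

Section BialgHom.
Variable theta : bialg_hom A kG.

Definition bialg_hom_mx (i j : 'I_n) : kG := theta (coact_gen e i j).

Lemma bialg_hom_mx_mul : struct_const_compat e bialg_hom_mx.
Proof.
move=> a i j; rewrite /bialg_hom_mx.
under eq_bigr => u _ do rewrite -linearZ /=.
rewrite -linear_sum coact_gen_sol linear_sum; apply: eq_bigr => s _ /=.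
by rewrite linear_sum; apply: eq_bigr => t _; rewrite linearZ /= rmorphM.
Qed.

Lemma bialg_hom_mx_comul i j :
  comul (bialg_hom_mx i j) = \sum_(l < n) bialg_hom_mx i l ⊗ bialg_hom_mx l j.
Proof.
rewrite bialg_hom_comul [comul (coact_gen e i j)]coact_comulE linear_sum /=.
by apply: eq_bigr => l _; rewrite tens_mapE.
Qed.

Lemma bialg_hom_mx_counit i j : counit (bialg_hom_mx i j) = (i == j)%:R.
Proof. by rewrite bialg_hom_counit [LHS]coact_counitE. Qed.

Definition grading_of_hom : grading G h :=
  grading_of_mx bialg_hom_mx_mul bialg_hom_mx_comul bialg_hom_mx_counit.

Lemma grading_of_homP s x : x \in grading_of_hom s <-> homog bialg_hom_mx s x.
Proof. exact: (homog_spaceP bialg_hom_mx_comul). Qed.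

End BialgHom.

Lemma grading_of_hom_inj : injective grading_of_hom.
Proof.
move=> theta theta' tt'; apply: bialg_homP; apply: coact_alg_ext => a i.
rewrite -/(bialg_hom_mx theta a i) -/(bialg_hom_mx theta' a i).
(* The value at [x_ai] is [R a] at [e_i], and [R a] is determined by its values on the homogeneous
   vectors, which the two gradings share. *)
rewrite -!(coact_coord_nth e_basis); move: e`_i.
apply: (@grading_linear_ext _ _ _ (grading_of_hom theta)) => [||s x xs].
- exact: coact_coord_linear.
- exact: coact_coord_linear.
rewrite ((grading_of_homP _ _ _).1 xs).
by rewrite tt' in xs; rewrite ((grading_of_homP _ _ _).1 xs).
Qed.

Lemma grading_of_hom_surj (g : grading G h) : (forall s t : G, (s * t = t * s)%g) ->
  exists theta, grading_of_hom theta = g.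
Proof.
move=> GC.
have [theta thetaE] := bialg_hom_exists GC (degree_mx_mul g) (degree_mx_comul g)
  (degree_mx_counit g).
have mxE : bialg_hom_mx theta = degree_mx g.
  by apply/funext => i; apply/funext => j; exact: thetaE.
exists theta; apply: gradingP => s x.
(* Membership in degree [s] is the same coordinate equation on both sides, as [coact_coord] of
   [degree_mx g] is [degree_coord g]. *)
rewrite grading_of_homP degree_coordP /homog mxE.
by split=> H a; move: (H a); rewrite coact_coord_degree.
Qed.

End Correspondence.

Theorem proposition3p3 (k : fieldType) (G : groupType)
    (G_abelian : forall s t : G, (s * t = t * s)%g)
    (h : fdLeibnizType k) (n : nat) (e : n.-tuple h)
    (e_basis : basis_of fullv e) :
  exists Phi : bialg_hom (coact_alg e) (group_alg k G) -> grading G h,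
    bijective Phi /\
    forall (theta : bialg_hom (coact_alg e) (group_alg k G)) (s : G) (x : h),
      x \in Phi theta s <->
      tens_map idfun theta (coaction e x) = x ⊗ group_elt k s.
Proof.
exists (grading_of_hom e_basis); split=> [|theta s x]; last first.
  rewrite (tens_map_coaction_eq e_basis); exact: grading_of_homP.
have surj g := grading_of_hom_surj e_basis g G_abelian.
(* The inverse picks a preimage given by surjectivity; injectivity makes it two-sided. *)
pose inv g := sval (cid (surj g)).
have invK : cancel inv (grading_of_hom e_basis) by move=> g; rewrite /inv; case: cid.
by exists inv => //; apply: inj_can_sym invK (@grading_of_hom_inj _ _ _ _ _ e_basis).
Qed.
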